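(* Let $\Delta^{(0)}=(z_0^{(0)},z_1^{(0)},z_2^{(0)})$ be any spheric triangle with circumcenter $c$ and associated angle vector $\alpha^{(0)}=(\alpha_0^{(0)},\alpha_1^{(0)},\alpha_2^{(0)})$. Let $$A=\begin{pmatrix}\frac12&\frac12&0\\0&\frac12&\frac12\\\frac12&0&\frac12\end{pmatrix},$$ put $\alpha^{(n)}=A^n\alpha^{(0)}$ for $n\ge 0$, and let $\Delta^{(n)}$ be the spheric triangle with angle vector $\alpha^{(n)}$ constructed around $c$. Then the sequence $\Delta^{(n)}$ converges to a regular triangle.
   Context: A spheric triangle is a triple $(z_0,z_1,z_2)$ of points of the unit sphere $\mathbb{S}^2\subset\mathbb{R}^3$, its vertices, counted counterclockwise. Every spheric triangle has a circumscribed circle on the sphere; its center $c\in\mathbb{S}^2$ is the circumcenter. For $j\in\mathbb{Z}/3\mathbb{Z}$, the angle $\alpha_j$ is the angle at $c$ between the directions to $z_j$ and $z_{j+1}$, i.e. the angle of the counterclockwise rotation around the axis $c$ that takes $z_j$ to $z_{j+1}$; thus $\alpha_0+\alpha_1+\alpha_2=2\pi$. The triangle $\Delta^{(n)}$ with angle vector $\alpha^{(n)}$ constructed around $c$ has its vertices $z_j^{(n)}$ on the circle on the sphere around $c$ of radius $\|c-z_j^{(0)}\|$ (the circumscribed circle of $\Delta^{(0)}$), with consecutive angles $\alpha^{(n)}_0,\alpha^{(n)}_1,\alpha^{(n)}_2$ around $c$. (The transformation $\alpha\mapsto A\alpha$ is the one induced on angles by rotating each vertex $z_j$ around $c$ by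 $\alpha_j/2$.) A sequence of such triangles converges to a regular spheric triangle if its vectors of angles $(\alpha_0,\alpha_1,\alpha_2)\in\mathbb{R}^3$ converge to $(\frac{2\pi}{3},\frac{2\pi}{3},\frac{2\pi}{3})$ in the Euclidean norm. *)

(* Defs.v *)
From HB Require Import structures.
From mathcomp Require Import all_boot all_order all_algebra.
From mathcomp Require Import all_classical all_reals all_analysis.

Set Implicit Arguments.
Unset Strict Implicit.
Unset Printing Implicit Defensive.

Import Order.TTheory GRing.Theory Num.Theory.
Import numFieldNormedType.Exports.

Local Open Scope classical_set_scope.
Local Open Scope ring_scope.

Section Space.
Context {R : realType}.
Implicit Types (u v c : 'cV[R]_3).

Definition dot u v : R := \sum_i u i 0 * v i 0.

(* The norm that the library puts on matrices is the sup norm. *)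
Definition enorm u : R := Num.sqrt (dot u u).

(* Index arithmetic in 'I_3 is modulo 3, here and below. *)
Definition cross u v : 'cV[R]_3 :=
  \col_i (u (i + 1) 0 * v (i + 2) 0 - u (i + 2) 0 * v (i + 1) 0).

Definition sphere : set 'cV[R]_3 := [set u | enorm u = 1].

(* Rodrigues' formula: for c on the sphere, the rotation by theta around the
   axis c, counterclockwise as seen from outside the sphere at c. *)
Definition rotation c (theta : R) v : 'cV[R]_3 :=
  cos theta *: v + sin theta *: cross c v + ((1 - cos theta) * dot c v) *: c.

End Space.

Section Triangle.
Context {R : realType}.
Implicit Types (c : 'cV[R]_3) (z : 'I_3 -> 'cV[R]_3) (alpha : 'cV[R]_3).

(* Two of the vertices may coincide; a triple reduced to a single point is
   excluded, because its angles would all be 0 instead of adding up to 2 pi. *)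
Definition spheric_triangle z : Prop :=
  (forall j, sphere (z j)) /\ (exists i j, z i <> z j).

(* The axis of the circle through the vertices meets the sphere in two
   antipodal points; the circumcenter is the one around which z 0, z 1, z 2 are
   in counterclockwise order.  For points of a circle centered at c, the triple
   product vanishes exactly when two of them coincide, and otherwise its sign
   is the orientation of the triple around c. *)
Definition circumcenter c z : Prop :=
  [/\ sphere c,
      forall j, enorm (c - z j) = enorm (c - z 0)
    & 0 <= dot c (cross (z 1 - z 0) (z 2 - z 0))].

Definition angle_vector c z alpha : Prop :=
  forall j, 0 <= alpha j 0 < 2 * pi /\ rotation c (alpha j 0) (z j) = z (j + 1).

Definition constructed_around c (r : R) alpha z : Prop :=
  [/\ spheric_triangle z, circumcenter c z,
      forall j, enorm (c - z j) = r
    & angle_vector c z alpha].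

(* Around a given circumcenter, a triangle has exactly one angle vector. *)
Definition converges_to_regular c (Delta : nat -> 'I_3 -> 'cV[R]_3) : Prop :=
  exists alpha : nat -> 'cV[R]_3,
    (forall n, angle_vector c (Delta n) (alpha n)) /\
    enorm (alpha n - const_mx (2 * pi / 3)) @[n --> \oo] --> (0 : R).

End Triangle.

Definition matA (R : realType) : 'M[R]_3 :=
  \matrix_(i, j) nth 0 (nth [::] [:: [:: 1/2; 1/2;   0];
                                     [::   0; 1/2; 1/2];
                                     [:: 1/2;   0; 1/2]] i) j.

(* The triangle with a given angle vector around c is determined only up to
   rotation around c, hence a predicate on sequences of triangles. *)
Definition triangle_sequence (R : realType) (c : 'cV[R]_3)
    (z : 'I_3 -> 'cV[R]_3) (alpha : 'cV[R]_3)
    (Delta : nat -> 'I_3 -> 'cV[R]_3) : Prop :=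
  Delta 0%N = z /\
  forall n : nat,
    constructed_around c (enorm (c - z 0)) (matA R ^+ n *m alpha) (Delta n).

(* Main.v *)
Require Import Defs.
From mathcomp Require Import all_boot all_order all_algebra.
From mathcomp Require Import all_classical all_reals all_analysis.
From mathcomp Require Import ring lra.

Set Implicit Arguments.
Unset Strict Implicit.
Unset Printing Implicit Defensive.

Import Order.TTheory GRing.Theory Num.Theory.
Import numFieldNormedType.Exports.

Local Open Scope classical_set_scope.
Local Open Scope ring_scope.

(* Put r^2 = |z_0|^2 - <c, z_0>^2 > 0.  The rotation by the sum s of the three
   angles fixes z_0, so s is a multiple of 2 pi in [0, 6 pi), and the orientation
   of the triple is r^2 (sin alpha_0 + sin alpha_1 + sin alpha_2).  The value
   s = 0 would collapse the triangle.  For angles of sum 2 pi, the sum of the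
   sines is 4 times the product of the sines of the half-angles; applied to the
   angles 2 pi - alpha_j, this makes the orientation negative when s = 4 pi.
   Hence s = 2 pi.  On vectors of sum 0, A multiplies the Euclidean norm by 1/2. *)

(** * Case analysis and arithmetic on three cyclic indices *)

Lemma ord3_ind (P : 'I_3 -> Prop) : P 0 -> P 1 -> P 2 -> forall j, P j.
Proof.
move=> P0 P1 P2 [[|[|[|//]]] lt_j3].
- by rewrite (_ : Ordinal _ = 0) //; apply: val_inj.
- by rewrite (_ : Ordinal _ = 1) //; apply: val_inj.
- by rewrite (_ : Ordinal _ = 2) //; apply: val_inj.
Qed.

Lemma ord3_add :
  ((0 + 1 = 1 :> 'I_3) * (1 + 1 = 2 :> 'I_3) * (2 + 1 = 0 :> 'I_3))
  * ((0 + 2 = 2 :> 'I_3) * (1 + 2 = 0 :> 'I_3) * (2 + 2 = 1 :> 'I_3)).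
Proof. by do !split; apply: val_inj. Qed.

Lemma sum_ord3 (V : nmodType) (F : 'I_3 -> V) :
  \sum_i F i = F 0 + F 1 + F 2.
Proof.
rewrite !big_ord_recl big_ord0 addr0 addrA.
by congr (_ + F _ + F _); apply: val_inj.
Qed.

(** * Trigonometry of three angles adding up to a multiple of a full turn *)

Section Angles.
Context {R : realType}.
Implicit Types (s a b d : R).

(** The duplication formula gives [cos (a / 2) ^+ 2 = 1], hence [sin (a / 2) = 0], whereas the sine
    is positive inside [(0, pi)]. *)
Lemma cos_eq1 a : 0 <= a < 2 * pi -> cos a = 1 -> a = 0.
Proof.
move=> a_bnd; have -> : a = (a / 2) *+ 2 by rewrite mulr2n; field.
rewrite cos_mulr2n => cos_a.
have [/eqP|a_neq0] := eqVneq (a / 2) 0; first by move/eqP->; rewrite mul0rn.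
have /sin_gt0_pi sin_gt0 : 0 < a / 2 < pi by lra.
have := sin2cos2 (a / 2); nra.
Qed.

Lemma cos_eq1_lt6pi s : 0 <= s < 6 * pi -> cos s = 1 ->
  [\/ s = 0, s = 2 * pi | s = 4 * pi].
Proof.
have cosB t : cos (t - pi *+ 2) = cos t.
  by rewrite -{2}(subrK (pi *+ 2) t) cosD2pi.
move=> s_bnd cos_s; have [s_lt|s_ge] := ltP s (2 * pi).
  by constructor 1; apply: cos_eq1 => //; lra.
have [s_lt4|s_ge4] := ltP s (4 * pi).
  have : s - pi *+ 2 = 0 by apply: cos_eq1; [lra|rewrite cosB].
  by constructor 2; lra.
have : s - pi *+ 2 - pi *+ 2 = 0 by apply: cos_eq1; [lra|rewrite !cosB].
by constructor 3; lra.
Qed.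

Lemma sum_sin a b d : a + b + d = 2 * pi ->
  sin a + sin b + sin d = 4 * (sin (a / 2) * sin (b / 2) * sin (d / 2)).
Proof.
move=> abd; set x := a / 2; set y := b / 2.
have -> : a = x *+ 2 by rewrite /x; lra.
have -> : b = y *+ 2 by rewrite /y; lra.
(* Everything becomes a polynomial in the sines and cosines of [x] and [y], so that [ring] concludes
   modulo the two Pythagorean relations. *)
have -> : d / 2 = - (x + y) + pi by rewrite /x /y; lra.
have -> : d = - ((x + y) *+ 2) + pi *+ 2 by rewrite /x /y; lra.
rewrite sinD2pi sinDpi !sinN opprK !sin_mulr2n sinD cosD.
have sx := sin2cos2 x; have sy := sin2cos2 y; ring: sx sy.
Qed.

(** Each angle is at most [2 * pi], so the half-angles lie in [[0, pi]]. This yields the orientation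
    of the constructed triangles. *)
Lemma sum_sin_ge0 a b d : a + b + d = 2 * pi -> 0 <= a -> 0 <= b -> 0 <= d ->
  0 <= sin a + sin b + sin d.
Proof.
by move=> abd a0 b0 d0; rewrite sum_sin // !mulr_ge0 ?sin_ge0_pi //; lra.
Qed.

Lemma sum_sin_lt0 a b d : a + b + d = 4 * pi ->
  a < 2 * pi -> b < 2 * pi -> d < 2 * pi -> sin a + sin b + sin d < 0.
Proof.
move=> abd a_lt b_lt d_lt.
have sinNB (t : R) : sin t = - sin (2 * pi - t).
  by rewrite -sinN opprB -(sinD2pi (t - _)); congr sin; ring.
(* The complements to [2 * pi] are positive with sum [2 * pi], so their halves lie strictly between
   0 and [pi]. *)
rewrite (sinNB a) (sinNB b) (sinNB d) -!opprD oppr_lt0 sum_sin; last by lra.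
by rewrite !mulr_gt0 ?sin_gt0_pi //; lra.
Qed.

End Angles.

(** * Vector algebra in coordinates and Rodrigues rotations *)

Section Rotations.
Context {R : realType}.
Implicit Types (u v c : 'cV[R]_3) (a b : R).

Lemma dotE u v : dot u v = u 0 0 * v 0 0 + u 1 0 * v 1 0 + u 2 0 * v 2 0.
Proof. exact: sum_ord3. Qed.

Lemma crossE u v :
  (cross u v 0 0 = u 1 0 * v 2 0 - u 2 0 * v 1 0) *
  (cross u v 1 0 = u 2 0 * v 0 0 - u 0 0 * v 2 0) *
  (cross u v 2 0 = u 0 0 * v 1 0 - u 1 0 * v 0 0).
Proof. by rewrite !mxE !ord3_add. Qed.

Lemma col3P u v :
  u 0 0 = v 0 0 -> u 1 0 = v 1 0 -> u 2 0 = v 2 0 -> u = v.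
Proof.
by move=> uv0 uv1 uv2; apply/colP; apply: ord3_ind.
Qed.

Lemma subE u v j : (u - v) j 0 = u j 0 - v j 0.
Proof. by rewrite !mxE. Qed.

Lemma rotE c a v j : rotation c a v j 0 =
  cos a * v j 0 + sin a * cross c v j 0 + (1 - cos a) * dot c v * c j 0.
Proof. by rewrite /rotation; move: (cross c v) => w; rewrite !mxE. Qed.

Lemma dot_ge0 u : 0 <= dot u u.
Proof. by apply: sumr_ge0 => i _; rewrite -expr2 sqr_ge0. Qed.

Lemma dot_eq0 u : dot u u = 0 -> u = 0.
Proof.
move/eqP; rewrite psumr_eq0; last by move=> i _; rewrite -expr2 sqr_ge0.
move/allP => u0; apply/colP => i; rewrite mxE; apply/eqP.
by have := u0 i (mem_index_enum i); rewrite mulf_eq0 orbb.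
Qed.

Lemma enorm1P u : enorm u = 1 <-> dot u u = 1.
Proof.
rewrite /enorm; split=> [u1|->]; last exact: sqrtr1.
by rewrite -(sqr_sqrtr (dot_ge0 u)) u1 expr1n.
Qed.

Lemma enorm_eqP u v : enorm u = enorm v <-> dot u u = dot v v.
Proof.
rewrite /enorm; split=> [uv|-> //].
by rewrite -(sqr_sqrtr (dot_ge0 u)) uv sqr_sqrtr ?dot_ge0.
Qed.

Lemma dot_sub u v : dot (u - v) (u - v) = dot u u - 2 * dot u v + dot v v.
Proof. rewrite !dotE !mxE; ring. Qed.

Lemma rotation0 c v : rotation c 0 v = v.
Proof. by rewrite /rotation cos0 sin0 subrr mul0r !scale0r !addr0 scale1r. Qed.

Lemma dot_rotation_self c a v : dot v (rotation c a v) =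
  dot v v - (1 - cos a) * (dot v v - dot c v ^+ 2).
Proof. by rewrite dotE !rotE !crossE !dotE; ring. Qed.

Lemma rotation_fixed c a v : 0 < dot v v - dot c v ^+ 2 ->
  rotation c a v = v -> cos a = 1.
Proof.
by move=> r_gt0 rot_v; have := dot_rotation_self c a v; rewrite rot_v; nra.
Qed.

Section UnitAxis.
Variable c : 'cV[R]_3.
Hypothesis c1 : dot c c = 1.

(** Oriented as a reduction rule for [ring], which then works modulo the equation of the unit
    sphere. *)
Let c0E : c 0 0 ^+ 2 = 1 - c 1 0 ^+ 2 - c 2 0 ^+ 2.
Proof. by move: c1; rewrite dotE => <-; ring. Qed.

Lemma dot_rotation a v : dot c (rotation c a v) = dot c v.
Proof. rewrite dotE !rotE !crossE !dotE; ring: c0E. Qed.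

Lemma rotationD a b v :
  rotation c a (rotation c b v) = rotation c (a + b) v.
Proof.
by apply: col3P; rewrite [LHS]rotE dot_rotation !crossE !rotE !crossE cosD sinD
  !dotE; ring: c0E.
Qed.

Lemma dot_rotation2 a v : dot (rotation c a v) (rotation c a v) = dot v v.
Proof.
have sE := sin2cos2 a.
rewrite dotE !rotE !crossE !dotE; ring: c0E sE.
Qed.

Lemma enorm_rotation a v : enorm (rotation c a v) = enorm v.
Proof. by apply/enorm_eqP; exact: dot_rotation2. Qed.

Lemma enorm_sub_rotation a v : enorm (c - rotation c a v) = enorm (c - v).
Proof. by apply/enorm_eqP; rewrite !dot_sub dot_rotation dot_rotation2. Qed.

(** This is the squared distance of [v] to the axis; its vanishing puts [v] on the axis. *)
Lemma dot_proj v : dot (v - dot c v *: c) (v - dot c v *: c) =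
  dot v v - dot c v ^+ 2.
Proof.
have dotZr h : dot v (h *: c) = h * dot c v by rewrite !dotE !mxE; ring.
have dotZZ h : dot (h *: c) (h *: c) = h ^+ 2 * dot c c.
  by rewrite !dotE !mxE; ring.
by rewrite dot_sub dotZr dotZZ c1; ring.
Qed.

(** Turns the orientation condition of [circumcenter] into trigonometry: when a third angle
    completes [a + b] to full turns, its sine is [- sin (a + b)]. *)
Lemma triple_rotation a b v :
  dot c (cross (rotation c a v - v) (rotation c (a + b) v - v)) =
  (dot v v - dot c v ^+ 2) * (sin a + sin b - sin (a + b)).
Proof.
have sa := sin2cos2 a; have sb := sin2cos2 b.
rewrite dotE !crossE !subE !rotE !crossE cosD sinD !dotE.
ring: c0E sa sb.
Qed.

End UnitAxis.

End Rotations.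

(** * Angle sum of a triangle, and construction of a triangle from its angles *)

Section Triangles.
Context {R : realType}.
Implicit Types (c v : 'cV[R]_3) (z : 'I_3 -> 'cV[R]_3) (alpha beta : 'cV[R]_3).

Lemma circle_dot c z (j : 'I_3) : spheric_triangle z ->
  (forall j, enorm (c - z j) = enorm (c - z 0)) -> dot c (z j) = dot c (z 0).
Proof.
move=> [z_sphere _] z_circle.
have := (enorm_eqP _ _).1 (z_circle j); rewrite !dot_sub.
by rewrite ((enorm1P _).1 (z_sphere j)) ((enorm1P _).1 (z_sphere 0)); lra.
Qed.

(** All vertices have norm 1 and the same height along [c]. If one lay on the axis, all would equal
    the same multiple of [c], but two of them differ. *)
Lemma circle_radius_gt0 c z : dot c c = 1 -> spheric_triangle z ->
  (forall j, enorm (c - z j) = enorm (c - z 0)) ->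
  0 < dot (z 0) (z 0) - dot c (z 0) ^+ 2.
Proof.
move=> c1 z_tri z_circle; rewrite -dot_proj // lt_neqAle dot_ge0 andbT eq_sym.
apply/eqP => /[dup] r0 /dot_eq0 /subr0_eq z0E.
have [z_sphere [i [j]]] := z_tri; apply.
have zE k : z k = dot c (z 0) *: c.
  apply: subr0_eq; apply: dot_eq0; rewrite -(circle_dot k z_tri z_circle).
  rewrite dot_proj // (circle_dot k z_tri z_circle) ((enorm1P _).1 (z_sphere k)).
  by move: r0; rewrite dot_proj // ((enorm1P _).1 (z_sphere 0)).
by rewrite (zE i) (zE j).
Qed.

Lemma sum_angle_vector c z alpha :
  spheric_triangle z -> circumcenter c z -> angle_vector c z alpha ->
  \sum_j alpha j 0 = 2 * pi.
Proof.
move=> z_tri [/enorm1P c1 z_circle z_ccw] z_alpha.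
have r_gt0 := circle_radius_gt0 c1 z_tri z_circle.
have [a0 z1E] := z_alpha 0; have [a1 z2E] := z_alpha 1.
have [a2 z0E] := z_alpha 2.
move: z1E z2E z0E; rewrite !ord3_add => z1E z2E z0E.
have z2E' : rotation c (alpha 0 0 + alpha 1 0) (z 0) = z 2.
  by rewrite addrC -rotationD // z1E.
have cos_sum : cos (alpha 2 0 + (alpha 0 0 + alpha 1 0)) = 1.
  by apply: (rotation_fixed r_gt0); rewrite -rotationD // z2E'.
have {z_ccw} sin_ge0 : 0 <= sin (alpha 0 0) + sin (alpha 1 0) -
    sin (alpha 0 0 + alpha 1 0).
  by move: z_ccw; rewrite -z2E' -z1E triple_rotation // pmulr_rge0.
rewrite sum_ord3.
have s_bnd : 0 <= alpha 2 0 + (alpha 0 0 + alpha 1 0) < 6 * pi by lra.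
case: (cos_eq1_lt6pi s_bnd cos_sum) => s_eq; last 2 first.
- by lra.
- have := @sum_sin_lt0 _ (alpha 0 0) (alpha 1 0) (alpha 2 0).
  (* For sum [4 * pi], two full turns are added, and the negative sum of sines contradicts
     [sin_ge0]. *)
  have -> : sin (alpha 2 0) = - sin (alpha 0 0 + alpha 1 0).
    rewrite -sinN -(sinD2pi (- _)) -(sinD2pi (_ + pi *+ 2)).
    by congr sin; lra.
  by lra.
(* In the remaining case the nonnegative angles have sum 0. *)
have zero j : alpha j 0 = 0 by move: j; apply: ord3_ind; lra.
have [_ [i [j]]] := z_tri; case.
have zz k : z k = z 0.
  move: k; apply: ord3_ind => //; first by rewrite -z1E zero rotation0.
  by rewrite -z2E' !zero addr0 rotation0.
by rewrite (zz i) (zz j).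
Qed.

(** The representative, among triangles equal up to rotation around [c], whose vertex 0 is [v]:
    partial sums of the angles locate the others. *)
Definition triangle_from c v beta (j : 'I_3) : 'cV[R]_3 :=
  rotation c (\sum_(i < 3 | (i < j)%N) beta i 0) v.

Lemma triangle_fromE c v beta :
  (triangle_from c v beta 0 = v) *
  (triangle_from c v beta 1 = rotation c (beta 0 0) v) *
  (triangle_from c v beta 2 = rotation c (beta 0 0 + beta 1 0) v).
Proof.
by rewrite /triangle_from; do !split;
  rewrite big_mkcond sum_ord3 /= ?addr0 ?rotation0.
Qed.

Lemma triangle_from_constructed c v beta :
  dot c c = 1 -> dot v v = 1 -> 0 < dot v v - dot c v ^+ 2 ->
  (forall j, 0 <= beta j 0 < 2 * pi) -> \sum_j beta j 0 = 2 * pi ->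
  constructed_around c (enorm (c - v)) beta (triangle_from c v beta).
Proof.
move=> c1 v1 r_gt0 beta_bnd; rewrite sum_ord3 => beta_sum.
have z_circle j : enorm (c - triangle_from c v beta j) = enorm (c - v).
  exact: enorm_sub_rotation.
have z_beta : angle_vector c (triangle_from c v beta) beta.
  move=> j; split=> //; move: j; apply: ord3_ind;
    rewrite !ord3_add !triangle_fromE // rotationD //.
    by rewrite addrC.
  (* The last side closes the triangle after one full turn. *)
  have -> : beta 2 0 + (beta 0 0 + beta 1 0) = 0 + pi *+ 2 by lra.
  by rewrite /rotation cosD2pi sinD2pi -/(rotation c 0 v) rotation0.
split=> //; last first.
- split=> [|j|]; first exact/enorm1P.
  + by rewrite !z_circle.
  rewrite !triangle_fromE triple_rotation // mulr_ge0 ?(ltW r_gt0) //.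
  have -> : beta 0 0 + beta 1 0 = - beta 2 0 + pi *+ 2 by lra.
  rewrite sinD2pi sinN opprK; apply: sum_sin_ge0 => //.
  + by case/andP: (beta_bnd 0).
  + by case/andP: (beta_bnd 1).
  + by case/andP: (beta_bnd 2).
split=> [j|]; first by rewrite /sphere /= enorm_rotation //; apply/enorm1P.
apply: contrapT => z_const.
have z_eq i j : triangle_from c v beta i = triangle_from c v beta j.
  by apply: contrapT => z_neq; apply: z_const; exists i, j.
(* If all vertices coincided, every rotation by [beta j 0] would fix [v], which is off the axis; the
   sum [2 * pi] forbids this. *)
have beta0 : forall j, beta j 0 = 0.
  move=> j; apply: cos_eq1 => //.
  apply: (@rotation_fixed _ c _ v) => //.
  have [_] := z_beta j.
  by rewrite (z_eq j 0) (z_eq (j + 1) 0) triangle_fromE.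
by move: beta_sum; rewrite !beta0; have := pi_gt0 R; lra.
Qed.

End Triangles.

(** * Iteration of the averaging matrix *)

Section Averaging.
Context {R : realType}.
Implicit Types (alpha : 'cV[R]_3).

Lemma matAE alpha j :
  (matA R *m alpha) j 0 = (alpha j 0 + alpha (j + 1) 0) / 2.
Proof.
by move: j; apply: ord3_ind; rewrite ord3_add mxE sum_ord3 !mxE /=; lra.
Qed.

(** Averaging two angles stays in the interval, and the columns of [matA] sum to 1. So the iterates
    remain admissible for [triangle_from_constructed]. *)
Lemma matAX_angles alpha n : (forall j, 0 <= alpha j 0 < 2 * pi) ->
  \sum_j alpha j 0 = 2 * pi ->
  (forall j, 0 <= (matA R ^+ n *m alpha) j 0 < 2 * pi) /\
  \sum_j (matA R ^+ n *m alpha) j 0 = 2 * pi.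
Proof.
move=> alpha_bnd alpha_sum.
elim: n => [|n [IHbnd IHsum]]; first by rewrite expr0 mul1mx.
rewrite exprS -mulmxA; split=> [j|].
  by rewrite matAE; have := IHbnd j; have := IHbnd (j + 1); lra.
by move: IHsum; rewrite !sum_ord3 !matAE !ord3_add; lra.
Qed.

(* On deviations of sum 0, (A d)_j = (d_j + d_(j+1)) / 2 = - d_(j+2) / 2. *)
Lemma enorm_matAX alpha n : \sum_j alpha j 0 = 2 * pi ->
  enorm (matA R ^+ n *m alpha - const_mx (2 * pi / 3)) =
  (1 / 2) ^+ n * enorm (alpha - const_mx (2 * pi / 3)).
Proof.
move=> alpha_sum.
suff [_ dotX] : \sum_j (matA R ^+ n *m alpha) j 0 = 2 * pi /\
    dot (matA R ^+ n *m alpha - const_mx (2 * pi / 3))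
        (matA R ^+ n *m alpha - const_mx (2 * pi / 3)) =
    ((1 / 2) ^+ n) ^+ 2 *
    dot (alpha - const_mx (2 * pi / 3)) (alpha - const_mx (2 * pi / 3)).
  by rewrite /enorm dotX sqrtrM ?sqr_ge0 // sqrtr_sqr ger0_norm // exprn_ge0.
elim: n => [|n [IHsum IHdot]]; first by rewrite !expr0 mul1mx expr1n mul1r.
rewrite [matA R ^+ _]exprS -mulmxA [(1 / 2) ^+ _.+1]exprS exprMn
  -[_ * _ * dot _ _]mulrA -IHdot.
move: (matA R ^+ n *m alpha) IHsum => b; rewrite !sum_ord3.
rewrite !dotE !subE !matAE !ord3_add !(mxE const_mx_key) => b_sum.
split; first by lra.
(* Eliminating the last angle uses the sum condition, without which the factor would not be exactly
   [1 / 2]. *)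
have -> : b 2 0 = 2 * pi - b 0 0 - b 1 0 by lra.
by field.
Qed.

End Averaging.

Theorem theorem3 (R : realType) (z : 'I_3 -> 'cV[R]_3) (c : 'cV[R]_3)
    (alpha : 'cV[R]_3) (hz : spheric_triangle z) (hc : circumcenter c z)
    (halpha : angle_vector c z alpha) :
  (exists Delta : nat -> 'I_3 -> 'cV[R]_3,
     triangle_sequence c z alpha Delta) /\
  (forall Delta : nat -> 'I_3 -> 'cV[R]_3,
     triangle_sequence c z alpha Delta -> converges_to_regular c Delta).
Proof.
have alpha_sum := sum_angle_vector hz hc halpha.
split=> [|Delta [_ hDelta]].
  have [/enorm1P c1 z_circle _] := hc.
  (* Index 0 is set apart because [triangle_sequence] demands [z] itself there. *)
  exists (fun n => if n is 0%N then z
                   else triangle_from c (z 0) (matA R ^+ n *m alpha)).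
  split=> // -[|n]; first by rewrite expr0 mul1mx.
  have [beta_bnd beta_sum] :=
    matAX_angles n.+1 (fun j => (halpha j).1) alpha_sum.
  apply: triangle_from_constructed => //; last exact: circle_radius_gt0.
  by apply/enorm1P; apply: hz.1.
exists (fun n => matA R ^+ n *m alpha); split=> [n|].
  by have [] := hDelta n.
under eq_fun do rewrite enorm_matAX //.
(* The limit is written as a product, to match a geometric sequence of ratio [1 / 2] times a
   constant. *)
rewrite -[0 : R](mul0r (enorm (alpha - const_mx (2 * pi / 3)))).
apply: cvgMl; apply: cvg_expr.
by rewrite ger0_norm; lra.
Qed.
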